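(* Let $\kappa=\tfrac12\,d\circ\chi^{-1}\circ d^*\in\mathrm{End}(\Omega^1(G))$. The determinantal random spanning subgraph of $G$ induced by the kernel $\kappa$ and the orthonormal basis $(e^\star/\sqrt{x_e})_{e\in E^+}$ of $\Omega^1(G)$ is almost surely a spanning forest (that is, almost surely acyclic).
   Context: Let $\mathbb K=\mathbb R$ or $\mathbb C$. $G=(V,E)$ is a finite connected graph with at least one edge: $V$ is a finite set of vertices and $E$ a finite set of oriented edges, with source and target maps $s,t:E\to V$ and a fixed-point-free involution $e\mapsto e^{-1}$ of $E$ exchanging source and target. $E^+\subset E$ is a fixed subset containing exactly one element of each pair $\{e,e^{-1}\}$. Positive weights $(x_e)_{e\in E}$ with $x_{e^{-1}}=x_e$ are given. A subgraph is a subset $S\subseteq E$ stable under $e\mapsto e^{-1}$, seen as the graph $(V,S)$ (always spanning) and identified with $S\cap E^+$. $\Omega^0(G)$ is the space of functions $V\to\mathbb K$ with $\langle f,g\rangle=\sum_v\overline{f(v)}g(v)$; $\Omega^1(G)$ is the space of functions $\alpha:E\to\mathbb K$ with $\alpha(e^{-1})=-\alpha(e)$, with $\langle\alpha,\beta\rangle=\sum_{e\in E^+}x_e\overline{\alpha(e)}\beta(e)$; $e^\star\in\Omega^1(G)$, $e\in E^+$, is the form equal to $1$ on $e$, $-1$ on $e^{-1}$ and $0$ elsewhere. $d:\Omega^0(G)\to\Omega^1(G)$, $df(e)=f(t(e))-f(s(e))$, and $d^*$ is its adjoint. $\chi:\Omega^0(G)\to\Omega^0(G)$ is the multiplication operator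 $(\chi f)(v)=\big(\sum_{e\in E:\,t(e)=v}x_e\big)f(v)$. The operator $\kappa$ is self-adjoint and satisfies $0\le\kappa\le1$. For a self-adjoint operator $\kappa$ with $0\le\kappa\le 1$ on an inner product space with an orthonormal basis indexed by a finite set $S$, the determinantal random subset $X$ of $S$ with kernel $\kappa$ in this basis is the one whose law is characterized by $\mathbb P(J\subseteq X)=\det(\kappa^J_J)$ for all $J\subseteq S$, where $\kappa^J_J$ is the submatrix of the matrix of $\kappa$ in the basis with rows and columns in $J$. *)

(* Defs.v *)
From HB Require Import structures.
From mathcomp Require Import all_boot all_order all_algebra.
From mathcomp Require Import all_classical all_reals all_analysis.
From mathcomp Require Import complex.

Set Implicit Arguments.
Unset Strict Implicit.
Unset Printing Implicit Defensive.

Import Order.TTheory GRing.Theory Num.Theory.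

Local Open Scope ring_scope.
Local Open Scope classical_set_scope.

Variant scalars := RealScalars | ComplexScalars.

Definition scalar (R : realType) (k : scalars) : numFieldType :=
  match k with
  | RealScalars => R : numFieldType
  | ComplexScalars => R[i] : numFieldType
  end.

Definition of_real (R : realType) (k : scalars) : R -> scalar R k :=
  match k with
  | RealScalars => fun a => a
  | ComplexScalars => fun a => real_complex R a
  end.

Definition conj (R : realType) (k : scalars) : scalar R k -> scalar R k :=
  match k with
  | RealScalars => fun z => z
  | ComplexScalars => fun z => conjc z
  end.

Section ScalarMorphisms.
Variables (R : realType) (k : scalars).

Fact of_real_additive : zmod_morphism (@of_real R k).
Proof. by case: k => // a b; rewrite /of_real rmorphB. Qed.

Fact of_real_multiplicative : monoid_morphism (@of_real R k).
Proof. by case: k => //; split=> [|a b]; rewrite /of_real ?rmorphM ?rmorph1. Qed.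

HB.instance Definition _ :=
  GRing.isZmodMorphism.Build R (scalar R k) (@of_real R k) of_real_additive.
HB.instance Definition _ :=
  GRing.isMonoidMorphism.Build R (scalar R k) (@of_real R k)
    of_real_multiplicative.

Fact conj_additive : zmod_morphism (@conj R k).
Proof. by case: k => // a b; rewrite /conj rmorphB. Qed.

Fact conj_multiplicative : monoid_morphism (@conj R k).
Proof. by case: k => //; split=> [|a b]; rewrite /conj ?rmorphM ?rmorph1. Qed.

HB.instance Definition _ :=
  GRing.isZmodMorphism.Build (scalar R k) (scalar R k) (@conj R k) conj_additive.
HB.instance Definition _ :=
  GRing.isMonoidMorphism.Build (scalar R k) (scalar R k) (@conj R k)
    conj_multiplicative.

Lemma conj_of_real (a : R) : conj (of_real k a) = of_real k a.
Proof. by case: k => //=; exact: conjc_real. Qed.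

End ScalarMorphisms.

(* Loops and multiple edges are allowed; tgt (einv e) = src e follows. *)
Record graph := Graph {
  vertex : finType;
  edge : finType;
  src : edge -> vertex;
  tgt : edge -> vertex;
  einv : edge -> edge;
  einvK : involutive einv;
  einv_neq : forall e, einv e != e;
  src_einv : forall e, src (einv e) = tgt e
}.

Arguments src {g}.
Arguments tgt {g}.
Arguments einv {g}.

Lemma tgt_einv (G : graph) (e : edge G) : tgt (einv e) = src e.
Proof. by rewrite -src_einv einvK. Qed.

Definition connected_graph (G : graph) : Prop :=
  forall u v : vertex G,
    connect [rel a b | [exists e : edge G, (src e == a) && (tgt e == b)]] u v.

Definition orientation (G : graph) (Ep : {set edge G}) : Prop :=
  forall e : edge G, (einv e \in Ep) = (e \notin Ep).

(* A cycle is a closed walk with distinct vertices. The last condition only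
   discards the backtracking walks e, e^-1; loops and pairs of parallel edges
   do form cycles. *)
Definition is_cycle (G : graph) (c : seq (edge G)) : bool :=
  [&& c != [::], path.cycle (fun e f => tgt e == src f) c,
      uniq [seq src e | e <- c] & all (fun e => einv e \notin c) c].

Definition acyclic (G : graph) (S : {set edge G}) : Prop :=
  forall c : seq (edge G), is_cycle c -> ~~ all [in S] c.

Section InnerProductSpaces.
Variables (K : fieldType) (V W : vectType K).
Variables (ipV : V -> V -> K) (ipW : W -> W -> K).

Definition is_adjoint (f : 'Hom(V, W)) (g : 'Hom(W, V)) : Prop :=
  forall v w, ipW (f v) w = ipV v (g w).

Definition adjoint (f : 'Hom(V, W)) : 'Hom(W, V) :=
  xget 0 [set g | is_adjoint f g].

End InnerProductSpaces.

Section Bases.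
Variables (K : fieldType) (V : vectType K) (I : finType).

Definition family_tuple (b : I -> V) : #|I|.-tuple V :=
  [tuple b (enum_val i) | i < #|I|].

(* Entries of the matrix acting on columns: f (b j) = \sum_i entry i j *: b i. *)
Definition entry (b : I -> V) (f : 'End(V)) (i j : I) : K :=
  coord (family_tuple b) (enum_rank i) (f (b j)).

Definition minor (b : I -> V) (f : 'End(V)) (J : {set I}) : K :=
  \det (\matrix_(i < #|J|, j < #|J|) entry b f (enum_val i) (enum_val j)).

Lemma entryP (b : I -> V) (f : 'End(V)) (j : I) :
  basis_of fullv (family_tuple b) -> f (b j) = \sum_i entry b f i j *: b i.
Proof.
move=> hb; rewrite {1}(coord_basis hb (memvf (f (b j)))).
rewrite (reindex (@enum_val I I)) /=; last first.
  by exists enum_rank => i _; [exact: enum_valK | exact: enum_rankK].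
apply: eq_bigr => i _; rewrite /entry enum_valK; congr (_ *: _).
by rewrite (nth_map i) ?size_enum_ord // nth_ord_enum.
Qed.

End Bases.

Section DeterminantalSubsets.
Variables (R : realType) (k : scalars).
Variables (d : measure_display) (T : measurableType d) (P : probability T R).

Definition random_subset (I : finType) (X : T -> {set I}) : Prop :=
  forall A : {set I}, measurable [set w | X w = A].

Definition determinantal (V : vectType (scalar R k)) (kappa : 'End(V))
    (I : finType) (b : I -> V) (X : T -> {set I}) : Prop :=
  random_subset X /\
  forall J : {set I},
    of_real k (fine (P [set w | J \subset X w])) = minor b kappa J.

End DeterminantalSubsets.

Section Forms.
Variables (R : realType) (k : scalars) (G : graph).
Variables (x : edge G -> R) (Ep : {set edge G}).

Local Notation K := (scalar R k).
Local Notation xK e := (of_real k (x e)).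

Definition Omega0 : vectType K := {ffun vertex G -> K^o}.

Definition ip0 (f g : {ffun vertex G -> K^o}) : K :=
  \sum_v conj (f v : K) * (g v : K).

Definition symmetrize (a : {ffun edge G -> K^o}) : {ffun edge G -> K^o} :=
  [ffun e => a (einv e) + a e].

Fact symmetrize_linear : linear symmetrize.
Proof.
by move=> c a b; apply/ffunP => e; rewrite !ffunE scalerDr addrACA.
Qed.
HB.instance Definition _ := GRing.isLinear.Build K {ffun edge G -> K^o}
  {ffun edge G -> K^o} _ symmetrize symmetrize_linear.

Definition antisymmetric_forms : {vspace {ffun edge G -> K^o}} :=
  lker (linfun symmetrize).

Lemma antisymmetricP (a : {ffun edge G -> K^o}) :
  reflect (forall e, a (einv e) = - a e) (a \in antisymmetric_forms).
Proof.
rewrite memv_ker lfunE /=; apply: (iffP eqP) => [/ffunP h e|h].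
  by apply/eqP; rewrite -addr_eq0; have := h e; rewrite !ffunE => ->.
by apply/ffunP => e; rewrite !ffunE h addNr.
Qed.

Definition Omega1 : vectType K := subvs_of antisymmetric_forms.

Definition ip1 (a b : subvs_of antisymmetric_forms) : K :=
  \sum_(e in Ep) xK e * conj (vsval a e : K) * (vsval b e : K).

Definition estar_fun (e : edge G) : {ffun edge G -> K^o} :=
  [ffun e' => (e' == e)%:R - (e' == einv e)%:R].

Fact estar_subproof (e : edge G) : estar_fun e \in antisymmetric_forms.
Proof.
apply/antisymmetricP => e'; rewrite !ffunE opprB (inj_eq (inv_inj (@einvK G))).
by rewrite (inv_eq (@einvK G)).
Qed.

Definition estar (e : edge G) : Omega1 := Subvs (estar_subproof e).

Definition diff_fun (f : {ffun vertex G -> K^o}) : {ffun edge G -> K^o} :=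
  [ffun e => f (tgt e) - f (src e)].

Fact diff_subproof f : diff_fun f \in antisymmetric_forms.
Proof.
by apply/antisymmetricP => e; rewrite !ffunE tgt_einv src_einv opprB.
Qed.

Definition diff_form (f : Omega0) : Omega1 := Subvs (diff_subproof f).

Fact diff_form_linear : linear diff_form.
Proof.
move=> c f g; apply/val_inj/ffunP => e /=.
by rewrite !ffunE scalerBr opprD addrACA.
Qed.
HB.instance Definition _ :=
  GRing.isLinear.Build K Omega0 Omega1 _ diff_form diff_form_linear.

Definition diff : 'Hom(Omega0, Omega1) := linfun diff_form.

Definition codiff : 'Hom(Omega1, Omega0) := adjoint ip0 ip1 diff.

Lemma codiffP : orientation Ep -> (forall e, x (einv e) = x e) ->
  is_adjoint ip0 ip1 diff codiff.
Proof.
move=> hEp hx.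
pose g (a : Omega1) : Omega0 :=
  [ffun v => \sum_(e | tgt e == v) xK e *: (vsval a e)].
have g_lin : linear g.
  move=> c a b; apply/ffunP => v; rewrite !ffunE scaler_sumr -big_split /=.
  by apply: eq_bigr => e _; rewrite !ffunE scalerDr !scalerA mulrC.
pose gL := HB.pack_for {linear Omega1 -> Omega0} g
  (GRing.isLinear.Build _ _ _ _ g g_lin).
suff h : is_adjoint ip0 ip1 diff (linfun gL).
  by rewrite /codiff /adjoint; case: xgetP => [_ -> //|/(_ _ h)].
move=> f a; rewrite !lfunE /= /ip0 /ip1 /=.
pose F e := xK e * conj (f (tgt e) : K) * (vsval a e : K).
transitivity (\sum_e F e).
  rewrite [RHS](bigID [in Ep]) /=.
  rewrite [X in _ = _ + X](reindex_inj (inv_inj (@einvK G))) /=.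
  rewrite [X in _ = _ + X](eq_bigl [in Ep]); last first.
    by move=> e; rewrite hEp negbK.
  rewrite -big_split; apply: eq_bigr => e _ /=.
  rewrite /F hx tgt_einv ffunE (antisymmetricP _ (valP a)) rmorphB /=.
  by rewrite mulrBr mulrBl mulrN.
rewrite (partition_big (@tgt G) predT) //=; apply: eq_bigr => v _.
rewrite ffunE mulr_sumr; apply: eq_bigr => e /eqP <-.
by rewrite /F mulrA [xK e * _]mulrC.
Qed.

Definition degree (v : vertex G) : R := \sum_(e | tgt e == v) x e.

Definition mul_degree (f : {ffun vertex G -> K^o}) : {ffun vertex G -> K^o} :=
  [ffun v => of_real k (degree v) *: f v].

Fact mul_degree_linear : linear mul_degree.
Proof.
move=> c f g; apply/ffunP => v.
by rewrite !ffunE scalerDr !scalerA mulrC.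
Qed.
HB.instance Definition _ := GRing.isLinear.Build K {ffun vertex G -> K^o}
  {ffun vertex G -> K^o} _ mul_degree mul_degree_linear.

Definition chi : 'End(Omega0) := linfun mul_degree.

Lemma chi_invertible : connected_graph G -> (0 < #|edge G|)%N ->
  (forall e, 0 < x e) -> lker chi == 0%VS.
Proof.
move=> hG /card_gt0P[e0 _] hx; apply/lker0P => f g; rewrite !lfunE /= => hfg.
apply/ffunP => v; move/ffunP: hfg => /(_ v); rewrite !ffunE.
apply: scalerI; rewrite fmorph_eq0 gt_eqF //.
have [e he] : exists e : edge G, tgt e = v.
  have /connectP[p] := hG (tgt e0) v.
  case: (lastP p) => [_ ->|q w]; first by exists e0.
  rewrite last_rcons rcons_path => /andP[_ /existsP[e /andP[_ /eqP he]]] ->.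
  by exists e.
rewrite /degree (bigD1 e) ?he //=; apply: ltr_pwDl => //.
by apply: sumr_ge0 => i _; exact: ltW.
Qed.

Definition kappa : 'End(Omega1) := 2^-1 *: (diff \o chi^-1 \o codiff)%VF.

Definition pos_edge : finType := {e : edge G | e \in Ep}.

Definition edge_basis (e : pos_edge) : Omega1 :=
  (of_real k (Num.sqrt (x (val e))))^-1 *: estar (val e).

Lemma edge_basisE : orientation Ep -> forall e f : pos_edge,
  vsval (edge_basis e) (val f) =
  (of_real k (Num.sqrt (x (val e))))^-1 * (f == e)%:R.
Proof.
move=> hEp e f; rewrite /edge_basis linearZ /= !ffunE /=.
rewrite (_ : (val f == einv (val e)) = false) ?subr0 //.
by apply/eqP => h; have := valP f; rewrite h hEp (valP e).
Qed.

Lemma edge_basis_orthonormal : orientation Ep -> (forall e, 0 < x e) ->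
  forall e f : pos_edge, ip1 (edge_basis e) (edge_basis f) = (e == f)%:R.
Proof.
move=> hEp hx e f; rewrite /ip1 big_sub (bigD1 f) //.
rewrite big1 => [|a /negPf ne]; last first.
  by rewrite (edge_basisE hEp f a) ne !mulr0.
rewrite [LHS]addr0 (edge_basisE hEp e f) (edge_basisE hEp f f) eqxx mulr1.
rewrite [e == f]eq_sym; case: (f =P e) => [->|_]; last first.
  by rewrite mulr0 rmorph0 mulr0 mul0r.
rewrite mulr1 -fmorphV conj_of_real -!rmorphM /= -mulrA -invfM -expr2.
by rewrite sqr_sqrtr ?ltW // divff ?rmorph1 // gt_eqF.
Qed.

Lemma edge_basisP : orientation Ep -> (forall e, 0 < x e) ->
  basis_of fullv (family_tuple edge_basis).
Proof.
move=> hEp hx.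
have s0 e : of_real k (Num.sqrt (x e)) != 0.
  by rewrite fmorph_eq0 gt_eqF // sqrtr_gt0.
have sumE (c : pos_edge -> K) (f : pos_edge) :
    vsval (\sum_i c i *: edge_basis i) (val f) =
    c f * (of_real k (Num.sqrt (x (val f))))^-1.
  rewrite linear_sum sum_ffunE (bigD1 f) // big1 => [|i /negPf ne]; last first.
    by rewrite linearZ ffunE (edge_basisE hEp i f) eq_sym ne mulr0 scaler0.
  by rewrite [LHS]addr0 linearZ ffunE (edge_basisE hEp f f) eqxx mulr1.
have tupE (c : 'I_#|pos_edge| -> K) : \sum_i c i *: (family_tuple edge_basis)`_i
    = \sum_e c (enum_rank e) *: edge_basis e.
  rewrite (reindex (@enum_rank pos_edge)) /=; last first.
    by exists enum_val => i _; [exact: enum_rankK | exact: enum_valK].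
  apply: eq_bigr => e _; congr (_ *: _).
  by rewrite (nth_map (enum_rank e)) ?size_enum_ord // nth_ord_enum enum_rankK.
apply/andP; split.
  rewrite eqEsubv subvf /=; apply/subvP => a _.
  pose b : Omega1 := \sum_e
    (vsval a (val e) * of_real k (Num.sqrt (x (val e)))) *: edge_basis e.
  have abE (f : edge G) : f \in Ep -> vsval a f = vsval b f.
    by move=> hf; rewrite (sumE _ (exist _ f hf)) mulfK.
  have -> : a = b.
    apply/val_inj/ffunP => e; have [he|he] := boolP (e \in Ep).
      exact: abE.
    have := abE (einv e); rewrite hEp => /(_ he).
    by rewrite !(antisymmetricP _ (valP _)) => /oppr_inj.
  rewrite memv_suml // => e _; rewrite memvZ // memv_span //.
  have <- : tnth (family_tuple edge_basis) (enum_rank (e : pos_edge))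
      = edge_basis e by rewrite tnth_mktuple enum_rankK.
  exact: mem_tnth.
apply/freeP => c; rewrite tupE => h i.
have := sumE (fun e => c (enum_rank e)) (enum_val i).
rewrite h ffunE enum_valK => /esym/eqP.
by rewrite mulf_eq0 invr_eq0 (negPf (s0 _)) orbF => /eqP.
Qed.

Definition subgraph_of (A : {set pos_edge}) : {set edge G} :=
  [set e | [exists a in A, (e == val a) || (e == einv (val a))]]%SET.

End Forms.

(* Main.v *)
(* If the edges of J contain a cycle c, the flow along c with value 1 / x_e on
   its edges is orthogonal to all exact forms, hence is killed by the adjoint
   of d and by kappa.  Its coordinates are supported on J, so the minor of
   kappa on J vanishes and J is almost surely not contained in X. *)
Require Import Defs.
From mathcomp Require Import all_boot all_order all_algebra.
From mathcomp Require Import all_classical all_reals all_analysis.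

Import Order.TTheory GRing.Theory Num.Theory.

Local Open Scope ring_scope.

Lemma sum_path_telescope (V : zmodType) (G : graph) (g : vertex G -> V)
    (e : edge G) (p : seq (edge G)) :
  path (fun e f => tgt e == src f) e p ->
  \sum_(f <- e :: p) (g (tgt f) - g (src f)) = g (tgt (last e p)) - g (src e).
Proof.
elim: p e => [|f p IH] e /=; first by rewrite big_seq1.
case/andP=> /eqP ef /IH; rewrite big_cons => ->.
by rewrite ef addrC addrA subrK.
Qed.

Lemma sum_cycle_eq0 (V : zmodType) (G : graph) (g : vertex G -> V)
    (c : seq (edge G)) :
  path.cycle (fun e f => tgt e == src f) c ->
  \sum_(e <- c) (g (tgt e) - g (src e)) = 0.
Proof.
case: c => [|e p]; first by rewrite big_nil.
rewrite /= rcons_path => /andP[/sum_path_telescope -> /eqP ->].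
exact: subrr.
Qed.

(** Taking the coordinates of the relation [f (\sum_i u i *: b i) = 0] gives a linear dependence,
    with coefficients [u], among the columns indexed by [J]. It is nontrivial because [i0] must lie
    in [J]. *)
Lemma minor_eq0 (K : fieldType) (V : vectType K) (I : finType) (b : I -> V)
    (f : 'End(V)) (J : {set I}) (u : I -> K) (i0 : I) :
  (forall i, i \notin J -> u i = 0) -> u i0 != 0 ->
  f (\sum_i u i *: b i) = 0 -> minor b f J = 0.
Proof.
move=> uJ ui0 fu.
have i0J : i0 \in J by apply: contraNT ui0 => /uJ ->.
have entry_sum i : \sum_(j in J) u j * entry b f i j = 0.
  have := congr1 (coord (family_tuple b) (enum_rank i)) fu.
  rewrite !linear_sum linear0 (bigID [in J]) /= [X in _ + X]big1 => [|j /uJ ->].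
    by rewrite addr0; congr (_ = _); apply: eq_bigr => j _; rewrite !linearZ.
  by rewrite scale0r !linear0.
(* [det0P] wants a row vector acting from the left, whereas [entry_sum] combines columns; hence the
   transpose. *)
rewrite /minor -det_tr; apply/eqP/det0P.
exists (\row_(j < #|J|) u (enum_val j)).
  apply/negP => /eqP/rowP/(_ (enum_rank_in i0J i0)).
  by rewrite !mxE enum_rankK_in // => /eqP; apply/negP.
apply/rowP => i; rewrite !mxE -[RHS](entry_sum (enum_val i)) [RHS]big_enum_val.
by apply: eq_bigr => j _; rewrite !mxE.
Qed.

Section Forms.
Context (R : realType) (k : scalars) (G : graph).
Context (x : edge G -> R) (Ep : {set edge G}).
Context (hEp : orientation Ep).

Lemma sum_edge_basisE (u : pos_edge Ep -> Defs.scalar R k) (e : pos_edge Ep) :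
  vsval (\sum_i u i *: edge_basis k x i) (val e) =
  u e / of_real k (Num.sqrt (x (val e))).
Proof.
rewrite linear_sum sum_ffunE (bigD1 e) // big1 => [|i /negPf ne]; last first.
  by rewrite linearZ ffunE (edge_basisE k x hEp i e) eq_sym ne mulr0 scaler0.
by rewrite [LHS]addr0 linearZ ffunE (edge_basisE k x hEp e e) eqxx mulr1.
Qed.

(** By adjointness, testing against the indicator function of a vertex [v] reads off the value of
    [codiff a] at [v]. *)
Lemma codiff_eq0 (a : Omega1 R k G) : (forall e, x (einv e) = x e) ->
  (forall f, ip1 x Ep (Defs.diff R k G f) a = 0) -> codiff k x Ep a = 0.
Proof.
move=> hx h; apply/ffunP => v; rewrite ffunE.
pose f : {ffun vertex G -> (Defs.scalar R k)^o} := [ffun w => (w == v)%:R].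
have := h f; rewrite (codiffP hEp hx) /ip0 (bigD1 v) //= big1 => [|w /negPf ne].
  by rewrite ffunE eqxx rmorph1 mul1r addr0.
by rewrite ffunE ne rmorph0 mul0r.
Qed.

(** The second term accounts for edges of [Ep] that [c] traverses backwards. *)
Definition cycle_sign (c : seq (edge G)) (e : edge G) : Defs.scalar R k :=
  (e \in c)%:R - (einv e \in c)%:R.

(** The edges of [c] outside [Ep] are inverses of edges of [Ep]; reindexing by [einv] and
    antisymmetry of [a] turn their terms into the negative part of [cycle_sign]. *)
Lemma sum_cycle_sign (c : seq (edge G)) (a : edge G -> Defs.scalar R k) : uniq c ->
  (forall e, a (einv e) = - a e) ->
  \sum_(e in Ep) cycle_sign c e * a e = \sum_(e <- c) a e.
Proof.
move=> uc ha; rewrite (big_uniq _ uc) /= [RHS]big_mkcond [RHS](bigID [in Ep]) /=.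
rewrite [X in _ = _ + X](reindex_inj (inv_inj (@einvK G))) /=.
rewrite [X in _ = _ + X](eq_bigl [in Ep]); last first.
  by move=> e; rewrite hEp negbK.
rewrite -big_split; apply: eq_bigr => e _ /=.
rewrite /cycle_sign ha; case: (e \in c); case: (einv e \in c) => /=;
by rewrite ?subrr ?subr0 ?sub0r ?mul0r ?mul1r ?mulN1r ?addr0 ?add0r.
Qed.

(** Each basis form carries one factor [1 / sqrt (x e)]; the coefficient supplies the other, so the
    flow takes the value [cycle_sign c e / x e] on [e] in [Ep]. *)
Definition cycle_flow (c : seq (edge G)) : Omega1 R k G :=
  \sum_i (cycle_sign c (val i) / of_real k (Num.sqrt (x (val i))))
    *: edge_basis k x (i : pos_edge Ep).

Context (x_gt0 : forall e, 0 < x e).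

Lemma of_real_sqrt_neq0 e : of_real k (Num.sqrt (x e)) != 0.
Proof. by rewrite fmorph_eq0 gt_eqF // sqrtr_gt0. Qed.

Lemma cycle_flowE (c : seq (edge G)) (e : edge G) : e \in Ep ->
  of_real k (x e) * vsval (cycle_flow c) e = cycle_sign c e.
Proof.
move=> he; rewrite (sum_edge_basisE _ (exist _ e he)) /= -mulrA -invfM -rmorphM.
rewrite -expr2 sqr_sqrtr ?ltW // mulrC mulfVK //.
by rewrite fmorph_eq0 gt_eqF.
Qed.

(** The weights of [ip1] cancel those of the flow, leaving the sum along [c] of the increments of
    the conjugate of [f], which telescopes around the cycle. *)
Lemma diff_cycle_flow_orthogonal (c : seq (edge G)) f : is_cycle c ->
  ip1 x Ep (Defs.diff R k G f) (cycle_flow c) = 0.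
Proof.
case/and4P=> _ hc /map_uniq uc _.
rewrite /ip1 lfunE /=.
pose g v : Defs.scalar R k := Defs.conj (f v : Defs.scalar R k).
rewrite -[RHS](sum_cycle_eq0 _ _ g _ hc) -sum_cycle_sign //; last first.
  by move=> e; rewrite tgt_einv src_einv opprB.
apply: eq_bigr => e he.
by rewrite ffunE mulrAC cycle_flowE // rmorphB.
Qed.

Lemma kappa_cycle_flow (c : seq (edge G)) :
  (forall e, x (einv e) = x e) -> is_cycle c ->
  kappa k x Ep (cycle_flow c) = 0.
Proof.
move=> hx hc; rewrite /kappa scale_lfunE !comp_lfunE codiff_eq0 //.
  by rewrite !linear0.
by move=> f; exact: diff_cycle_flow_orthogonal.
Qed.

Lemma minor_cyclic_eq0 (A : {set pos_edge Ep}) (c : seq (edge G)) :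
  (forall e, x (einv e) = x e) ->
  is_cycle c -> all [in subgraph_of A] c ->
  minor (edge_basis k x (Ep:=Ep)) (kappa k x Ep) A = 0.
Proof.
move=> hx hc /allP cA.
(* Each unoriented edge has a single representative in [Ep], so an edge of [c] determines which
   element of [A] covers it. *)
have memA (i : pos_edge Ep) e : e \in c -> e = val i \/ e = einv (val i) ->
    i \in A.
  move=> /cA; rewrite inE => /existsP[j /andP[jA je]] ie.
  suff /val_inj -> : val i = val j by [].
  have ji : val j != einv (val i).
    by apply: contraL (valP j) => /eqP ->; rewrite hEp (valP i).
  case: ie je => -> /orP[] /eqP //.
  - by move=> h; move: ji; rewrite h einvK eqxx.
  - by move=> h; move: ji; rewrite h eqxx.
  - exact: (inv_inj (@einvK G)).
(* A cycle is nonempty and never uses an edge together with its inverse, so no cancellation occurs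
   in [cycle_sign] at [e0] or its inverse. *)
have [e0 e0c ce0] : exists2 e, e \in c & einv e \notin c.
  case/and4P: hc => c0 _ _ /allP hc; case: c c0 hc {cA memA} => // e c _ hc.
  by exists e; rewrite ?mem_head ?hc ?mem_head.
have [i0 i0P] : exists i : pos_edge Ep, cycle_sign c (val i) != 0.
  have [he|he] := boolP (e0 \in Ep).
    exists (exist _ e0 he).
    by rewrite /cycle_sign /= e0c (negPf ce0) subr0 oner_eq0.
  rewrite -hEp in he; exists (exist _ (einv e0) he).
  by rewrite /cycle_sign /= einvK e0c (negPf ce0) sub0r oppr_eq0 oner_eq0.
apply: (minor_eq0 _ _ _ _ _ _ _ i0 _ _ (kappa_cycle_flow _ hx hc)) => [i iA|].
  rewrite /cycle_sign; case: (boolP (val i \in c)) => [h|_].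
    by rewrite (memA i _ h) // in iA; left.
  case: (boolP (einv _ \in c)) => [h|_]; last by rewrite subrr mul0r.
  by rewrite (memA i _ h) // in iA; right.
by rewrite mulf_neq0 // invr_eq0 of_real_sqrt_neq0.
Qed.

End Forms.

Section RandomSubsets.
Local Open Scope classical_set_scope.
Context (R : realType) (d : measure_display) (T : measurableType d).
Context (P : probability T R) (I : finType) (X : T -> {set I}).

Lemma measurable_superset (A : {set I}) : random_subset X ->
  measurable [set w | A \subset X w].
Proof.
move=> hX.
rewrite (_ : [set _ | _] =
    \bigcup_(B in [set B : {set I} | A \subset B]) [set w | X w = B]).
  by apply: fin_bigcup_measurable => // B _; exact: hX.
by apply/seteqP; split=> [w AX|w [B AB XB]]; [exists (X w)|rewrite /= XB].
Qed.

(** The event [X w = A] lies in the event that [X w] contains [A], whose probability is the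
    vanishing minor. *)
Lemma determinantal_ae_neq (k : scalars) (V : vectType (Defs.scalar R k))
    (f : 'End(V)) (b : I -> V) (A : {set I}) :
  determinantal P f b X -> minor b f A = 0 -> {ae P, forall w, X w <> A}.
Proof.
case=> hX /(_ A) hA mA; have mS := measurable_superset A hX.
exists [set w | A \subset X w]; split => //.
- rewrite -[LHS]fineK ?fin_num_measure //; congr (_%:E).
  by apply: (fmorph_inj (of_real k)); rewrite rmorph0 -mA -hA.
- by move=> w /= /contrapT ->.
Qed.

End RandomSubsets.

Theorem theorem11p11 (R : realType) (k : scalars) (G : graph)
    (hconn : connected_graph G) (hedge : (0 < #|edge G|)%N)
    (x : edge G -> R) (x_gt0 : forall e, 0 < x e)
    (x_einv : forall e, x (einv e) = x e)
    (Ep : {set edge G}) (hEp : orientation Ep)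
    (d : measure_display) (T : measurableType d) (P : probability T R)
    (X : T -> {set pos_edge Ep})
    (hX : determinantal P (kappa k x Ep) (edge_basis k x (Ep:=Ep)) X) :
  {ae P, forall w, acyclic (subgraph_of (X w))}.
Proof.
(* Stating the exclusion as an implication covers every [A] uniformly; there are finitely many, so
   the almost sure events can be intersected. *)
have cyclic_neq (A : {set pos_edge Ep}) :
    {ae P, forall w, ~ acyclic (subgraph_of A) -> X w <> A}.
  have [hA|hA] := pselect (acyclic (subgraph_of A)).
    by apply: (aeW P) => w.
  have [c hc cA] : exists2 c, is_cycle c & all [in subgraph_of A] c.
    apply: contrapT => h; apply: hA => c hc.
    by apply/negP => cA; apply: h; exists c.
  have := minor_cyclic_eq0 _ k _ _ _ hEp x_gt0 A c x_einv hc cA.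
  move=> /(determinantal_ae_neq _ _ _ _ _ _ _ _ _ _ _ hX).
  by apply: filterS => w h _.
have : {ae P, forall w (A : {set pos_edge Ep}),
    ~ acyclic (subgraph_of A) -> X w <> A} by exact: filter_forall.
apply: filterS => w h.
by apply: contrapT => /h; apply.
Qed.
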